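(* Let $n\ge1$, $d_1>0$ and $b\in\Delta_n\setminus\{e_n\}$. Then $C_{+}(b)\setminus\{e_n\}$ is a disjoint union of $$\frac{4^{n-1}-1}{3}$$ global $\gamma$-orbits, and for each such orbit the centroids $P(c)$ of the three words $c$ in the orbit form a nondegenerate equilateral triangle centered at the origin. The set $C_{-}(b)$ is a transversal of exactly $4^{n-1}$ further global $\gamma$-orbits: each such orbit contains exactly one element of $C_{-}(b)$, while its other two elements anticommute with $b$.
   Context: $\Delta_n=\{1,2,4,7\}^n$ is the set of words of length $n$, and $e_n=77\cdots7$. Digits are identified with quaternionic symbols: $1=i$, $2=j$, $4=k$, $7=e$, where $e$ is the identity, $i^2=j^2=k^2=-e$, $ij=k=-ji$, $jk=i=-kj$, $ki=j=-ik$. Words are multiplied coordinate by coordinate, with the local quaternionic signs collected into one global sign, so that products lie in $\Delta_n\sqcup(-\Delta_n)$. $\gamma$ acts on words by applying $1\mapsto2\mapsto4\mapsto1$, $7\mapsto7$ in every coordinate (the global cyclic action). For $b\in\Delta_n$, $C_{+}(b)=\{c\in\Delta_n:cb=bc\text{ and }cb\in\Delta_n\}$ and $C_{-}(b)=\{c\in\Delta_n:cb=bc\text{ and }cb\in-\Delta_n\}$. Words $c,b$ anticommute if $cb=-bc$. The centroid map $P:\Delta_n\to\mathbb R^2$ is $P(c)=\sum_{r=1}^n\sigma_r d_r v(c_r)$, where $d_r=d_1/2^{r-1}$ for a fixed scale $d_1>0$, $\sigma_r=(-1)^{\#\{s<r:\,c_s=7\}}$, and $v(1)=(\cos 210^\circ,\sin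 210^\circ)$, $v(2)=(\cos 90^\circ,\sin 90^\circ)$, $v(4)=(\cos 330^\circ,\sin 330^\circ)$, $v(7)=(0,0)$. *)

(* Defs.v *)
From HB Require Import structures.
From mathcomp Require Import all_boot all_order all_algebra all_fingroup.
From mathcomp Require Import reals trigo.
Set Implicit Arguments.
Unset Strict Implicit.
Unset Printing Implicit Defensive.
Import Order.TTheory GRing.Theory Num.Theory.
Local Open Scope ring_scope.

(* The alphabet {1, 2, 4, 7}, with 1 = i, 2 = j, 4 = k and 7 = e. *)
Inductive digit := D1 | D2 | D4 | D7.

Definition digit_to_ord (x : digit) : 'I_4 :=
  match x with
  | D1 => inord 0 | D2 => inord 1 | D4 => inord 2 | D7 => inord 3
  end.

Definition digit_of_ord (k : 'I_4) : digit := nth D7 [:: D1; D2; D4] k.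

Lemma digit_to_ordK : cancel digit_to_ord digit_of_ord.
Proof. by case; rewrite /digit_of_ord /= inordK. Qed.

HB.instance Definition _ := Finite.copy digit (can_type digit_to_ordK).

Notation word n := {ffun 'I_n -> digit}.

Definition e_word (n : nat) : word n := [ffun=> D7].

(* The product of two of the symbols i, j, k, e, as a sign (true for minus)
   and a symbol. *)
Definition qmul (x y : digit) : bool * digit :=
  match x, y with
  | D7, _ => (false, y)
  | _, D7 => (false, x)
  | D1, D1 | D2, D2 | D4, D4 => (true, D7)
  | D1, D2 => (false, D4) | D2, D1 => (true, D4)
  | D2, D4 => (false, D1) | D4, D2 => (true, D1)
  | D4, D1 => (false, D2) | D1, D4 => (true, D2)
  end.

(* The disjoint union of Delta_n (false) and - Delta_n (true). *)
Notation sword n := (bool * word n)%type.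

Definition sopp (n : nat) (x : sword n) : sword n := (~~ x.1, x.2).

Definition wmul (n : nat) (c b : word n) : sword n :=
  (\big[addb/false]_(r < n) (qmul (c r) (b r)).1,
   [ffun r => (qmul (c r) (b r)).2]).

Definition wcommute (n : nat) (c b : word n) : bool := wmul c b == wmul b c.

Definition wanticommute (n : nat) (c b : word n) : bool :=
  wmul c b == sopp (wmul b c).

Definition Cplus (n : nat) (b : word n) : {set word n} :=
  [set c | wcommute c b & (wmul c b).1 == false].

Definition Cminus (n : nat) (b : word n) : {set word n} :=
  [set c | wcommute c b & (wmul c b).1 == true].

Definition cyc (x : digit) : digit :=
  match x with D1 => D2 | D2 => D4 | D4 => D1 | D7 => D7 end.

Definition cycw (n : nat) (c : word n) : word n := [ffun r => cyc (c r)].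

Lemma cycw_inj (n : nat) : injective (@cycw n).
Proof.
move=> c c' /ffunP cc'; apply/ffunP => r; move: (cc' r); rewrite !ffunE.
by case: (c r); case: (c' r).
Qed.

(* Its cycles porbit (gamma n) c are the global gamma-orbits, and
   porbits (gamma n) is the set of all of them. *)
Definition gamma (n : nat) : {perm word n} := perm (@cycw_inj n).

Section Plane.
Variable R : realType.

Definition point (x y : R) : 'rV[R]_2 := \row_j (if j == 0 then x else y).

Definition degree (a : R) : R := a * pi / 180.

Definition polar (a : R) : 'rV[R]_2 := point (cos (degree a)) (sin (degree a)).

Definition vdigit (x : digit) : 'rV[R]_2 :=
  match x with
  | D1 => polar 210 | D2 => polar 90 | D4 => polar 330 | D7 => 0
  end.

(* Positions are numbered from 0, so the scale d_1 / 2 ^ (r - 1) at position r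
   reads d1 / 2 ^+ r. *)
Definition centroid (n : nat) (d1 : R) (c : word n) : 'rV[R]_2 :=
  \sum_(r < n)
    ((-1) ^+ #|[set s : 'I_n | (s < r)%N & c s == D7]| * (d1 / 2 ^+ r))
      *: vdigit (c r).

(* Not the library norm on 'rV[R]_2, which is the sup norm. *)
Definition edist (p q : 'rV[R]_2) : R :=
  Num.sqrt (\sum_(j < 2) (p 0 j - q 0 j) ^+ 2).

Definition equilateral_triangle (p q s : 'rV[R]_2) : Prop :=
  edist p q = edist q s /\ edist q s = edist s p.

(* The three points are affinely independent. *)
Definition nondegenerate_triangle (p q s : 'rV[R]_2) : bool :=
  row_free (col_mx (q - p) (s - p)).

Definition centered_at_origin (p q s : 'rV[R]_2) : Prop :=
  3^-1 *: (p + q + s) = 0.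

End Plane.

(* Main.v *)
(* Since [y x] and [gamma(x) y] have the same sign for any two of the symbols
   i, j, k, e, the word [c] commutes with [b] iff [c b] and [gamma(c) b] have the
   same sign, and the signs of [c b], [gamma(c) b], [gamma^2(c) b] multiply to +.
   Along the orbit of [c] these signs are therefore +++ (all of the orbit lies in
   C_+), or a rotation of --+, where exactly one element is followed by its own
   sign - and lies in C_- while the other two anticommute with [b].

   At a position where the symbol of [b] is not e, the pairs of local signs of
   [x b_r] and [gamma(x) b_r] take each value for exactly one [x], so C_+ and C_-
   both have 4^(n-1) elements.

   The map gamma rotates centroids by -120 degrees, and a centroid vanishes only
   for e_n because the first nonzero term, of length d_1/2^(r-1), outweighs the
   sum of the lengths of the later ones. *)
Require Import Defs.
From HB Require Import structures.
From mathcomp Require Import all_boot all_order all_algebra all_fingroup.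
From mathcomp Require Import reals trigo ring lra.
Set Implicit Arguments.
Unset Strict Implicit.
Unset Printing Implicit Defensive.
Import Order.TTheory GRing.Theory Num.Theory.
Local Open Scope ring_scope.

(** * Signs of products and the sizes of C_+ and C_- *)

Section Signs.
Variable n : nat.
Implicit Types b c : word n.

Lemma qmul_symbolC (x y : digit) : (qmul x y).2 = (qmul y x).2.
Proof. by case: x; case: y. Qed.

Lemma wmul_symbolC c b : (wmul c b).2 = (wmul b c).2.
Proof. by apply/ffunP => r; rewrite !ffunE qmul_symbolC. Qed.

Lemma qmul_sign_cyc (x y : digit) : (qmul (cyc x) y).1 = (qmul y x).1.
Proof. by case: x; case: y. Qed.

Lemma wmul_sign_cyc c b : (wmul (cycw c) b).1 = (wmul b c).1.
Proof. by apply: eq_bigr => r _; rewrite ffunE qmul_sign_cyc. Qed.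

(** Checked position by position: if neither symbol is e, the three local products are one square,
    of sign -, and two products of opposite signs; otherwise all three signs are +. *)
Lemma wmul_sign_cyc2 c b :
  (wmul (cycw (cycw c)) b).1 = (wmul c b).1 (+) (wmul (cycw c) b).1.
Proof.
rewrite /= -big_split; apply: eq_bigr => r _ /=.
by rewrite !ffunE; case: (c r); case: (b r).
Qed.

Lemma wcommuteE c b : wcommute c b = ((wmul c b).1 == (wmul (cycw c) b).1).
Proof.
rewrite wmul_sign_cyc; apply/eqP/eqP => [->//|signs].
by rewrite [LHS]surjective_pairing wmul_symbolC signs -surjective_pairing.
Qed.

Lemma wanticommuteE c b :
  wanticommute c b = ((wmul c b).1 != (wmul (cycw c) b).1).
Proof.
rewrite wmul_sign_cyc; apply/eqP/idP => [->|].
  by case: (wmul b c) => [[]].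
rewrite [wmul c b]surjective_pairing wmul_symbolC /sopp.
by case: (wmul c b).1; case: (wmul b c).1.
Qed.

(** A uniform description of C_+ and C_-, so that a single count serves both. *)
Definition sign_class b (s : bool) : {set word n} :=
  [set c | ((wmul c b).1 == s) && ((wmul (cycw c) b).1 == s)].

Lemma CplusE b : Cplus b = sign_class b false.
Proof.
by apply/setP => c; rewrite !inE wcommuteE; case: (_.1); case: (_.1).
Qed.

Lemma CminusE b : Cminus b = sign_class b true.
Proof.
by apply/setP => c; rewrite !inE wcommuteE; case: (_.1); case: (_.1).
Qed.

Lemma Cplus_cyc b c : (cycw c \in Cplus b) = (c \in Cplus b).
Proof.
rewrite CplusE !inE wmul_sign_cyc2.
by case: (_.1); case: (_.1).
Qed.

Lemma Cminus_cyc b c : c \in Cminus b ->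
  [/\ cycw c \notin Cminus b, cycw (cycw c) \notin Cminus b,
      wanticommute (cycw c) b & wanticommute (cycw (cycw c)) b].
Proof.
rewrite CminusE !inE => /andP[/eqP p0 /eqP p1].
by rewrite !wanticommuteE !wmul_sign_cyc2 p0 p1.
Qed.

Lemma wmul_sign_e b : (wmul (e_word n) b).1 = false.
Proof. by rewrite /= big1 // => r _; rewrite ffunE. Qed.

Definition upd (r0 : 'I_n) c (x : digit) : word n :=
  [ffun r => if r == r0 then x else c r].

Definition sign_off (r0 : 'I_n) c b : bool :=
  \big[addb/false]_(r < n | r != r0) (qmul (c r) (b r)).1.

Lemma wmul_sign_split (r0 : 'I_n) c b :
  (wmul c b).1 = (qmul (c r0) (b r0)).1 (+) sign_off r0 c b.
Proof. by rewrite /= (bigD1 r0). Qed.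

Lemma eq_sign_off (r0 : 'I_n) c c' b : (forall r, r != r0 -> c r = c' r) ->
  sign_off r0 c b = sign_off r0 c' b.
Proof. by move=> cc'; apply: eq_bigr => r /cc'->. Qed.

Lemma cycw_upd (r0 : 'I_n) c x : cycw (upd r0 c x) = upd r0 (cycw c) (cyc x).
Proof. by apply/ffunP => r; rewrite !ffunE; case: eqP. Qed.

Lemma qmul_sign_inj (x x' y : digit) : y != D7 ->
  (qmul x y).1 = (qmul x' y).1 -> (qmul (cyc x) y).1 = (qmul (cyc x') y).1 ->
  x = x'.
Proof. by case: y => [|||/eqP//] _; case: x; case: x'. Qed.

Lemma qmul_sign_surj (s t : bool) (y : digit) : y != D7 ->
  exists x, (qmul x y).1 = s /\ (qmul (cyc x) y).1 = t.
Proof.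
case: y => [|||/eqP//] _; case: s; case: t;
  by [exists D1 | exists D2 | exists D4 | exists D7].
Qed.

Lemma card_digit : #|{: digit}| = 4.
Proof.
have digit_of_ordK : cancel digit_of_ord digit_to_ord.
  by case=> [[|[|[|[|//]]]] lt4]; apply: val_inj; rewrite /= inordK.
rewrite -[RHS](card_ord 4); apply: (bij_eq_card (f := digit_to_ord)).
by exists digit_of_ord; [apply: digit_to_ordK|].
Qed.

(* Every word has exactly one modification at a position [r0] with [b r0 != D7]
   that lies in the class, so the class times the alphabet is in bijection with
   all the words. *)
Lemma card_sign_class b s : b != e_word n -> #|sign_class b s| = (4 ^ n.-1)%N.
Proof.
move=> b_neq_e; have [r0 br0] : exists r0, b r0 != D7.
  apply/existsP; rewrite -negb_forall; apply: contra b_neq_e => /forallP be.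
  by apply/eqP/ffunP => r; rewrite ffunE; apply/eqP.
pose f (cx : word n * digit) := upd r0 cx.1 cx.2.
have f_inj : {in setX (sign_class b s) setT &, injective f}.
  move=> [c x] [c' x']; rewrite !in_setX !in_setT !andbT !inE.
  move=> /andP[/eqP s0 /eqP s1] /andP[/eqP s0' /eqP s1'] /ffunP ff.
  have := ff r0; rewrite !ffunE eqxx /= => xx'.
  have off r : r != r0 -> c r = c' r.
    by move=> /negPf r_neq; have := ff r; rewrite !ffunE r_neq.
  suff cr0 : c r0 = c' r0.
    rewrite xx'; congr pair; apply/ffunP => r.
    by have [->|/off] := eqVneq r r0.
  (* Both words have the same two global signs and the same contributions off [r0], hence the same
     two local signs at [r0]. *)
  apply: (qmul_sign_inj br0).
    apply: (@addIb (sign_off r0 c b)); rewrite [in RHS](eq_sign_off b off).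
    by rewrite -!wmul_sign_split; exact: etrans s0 (esym s0').
  apply: (@addIb (sign_off r0 (cycw c) b)).
  rewrite [in RHS](eq_sign_off (c' := cycw c')) => [|r /off cr]; last first.
    by rewrite !ffunE cr.
  by have := etrans s1 (esym s1'); rewrite !(wmul_sign_split r0) !ffunE.
have f_im : f @: setX (sign_class b s) setT = setT.
  apply/setP => w; rewrite inE; apply/imsetP.
  (* The symbol [y] cancels the contributions off [r0], so that both signs become [s]; the second
     component [w r0] restores [w]. *)
  have [y [y0 y1]] := qmul_sign_surj
    (s (+) sign_off r0 w b) (s (+) sign_off r0 (cycw w) b) br0.
  exists (upd r0 w y, w r0).
    rewrite !inE cycw_upd !(wmul_sign_split r0) !ffunE !eqxx y0 y1.
    rewrite (eq_sign_off (c' := w)) => [|r /negPf r_neq]; last first.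
      by rewrite ffunE r_neq.
    rewrite [sign_off _ (upd _ _ _) _](eq_sign_off (c' := cycw w)); last first.
      by move=> r /negPf r_neq; rewrite ffunE r_neq.
    by rewrite -!addbA !addbb !addbF !eqxx.
  by apply/ffunP => r; rewrite !ffunE /=; case: eqP => [->|].
(* The class has 4^n / 4 elements; the position [r0] witnesses that [n] is positive, as [n.-1]
   requires. *)
have := card_in_imset f_inj; rewrite f_im cardsX !cardsT card_ffun card_digit.
rewrite card_ord -[in (4 ^ n)%N](prednK (leq_ltn_trans (leq0n r0) (ltn_ord r0))).
by rewrite expnSr => /eqP; rewrite eqn_pmul2r // => /eqP.
Qed.

End Signs.

(** * Orbits of gamma *)

Section Orbits.
Variable n : nat.
Implicit Types b c : word n.

Lemma cycw3 c : cycw (cycw (cycw c)) = c.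
Proof. by apply/ffunP => r; rewrite !ffunE; case: (c r). Qed.

Lemma cycw_fixed c : (cycw c == c) = (c == e_word n).
Proof.
apply/eqP/eqP => [/ffunP cc|->]; apply/ffunP => r; rewrite !ffunE //.
by have := cc r; rewrite ffunE; case: (c r).
Qed.

(** Since gamma^3 = 1, gamma^2(c) = c would force gamma(c) = c, which happens only for
    [e_word n]. *)
Lemma cycw_uniq c : c != e_word n -> uniq [:: c; cycw c; cycw (cycw c)].
Proof.
rewrite -cycw_fixed => cc; have c2 : cycw (cycw c) != c.
  by apply: contraNneq cc => c2; rewrite -{2}[c]cycw3 c2.
by rewrite /= !inE negb_or ![c == _]eq_sym cc c2 (inj_eq (@cycw_inj n)) eq_sym cc.
Qed.

Lemma porbit_gamma c :
  porbit (gamma n) c = [set c; cycw c; cycw (cycw c)].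
Proof.
apply/setP => w; rewrite !inE; apply/idP/idP => [/porbitP[i ->]|].
  elim: i => [|i]; first by rewrite expg0 perm1 eqxx.
  rewrite expgSr permM permE => /orP[/orP[]|] /eqP->;
    by rewrite ?cycw3 eqxx ?orbT.
have step v : v \in porbit (gamma n) c -> cycw v \in porbit (gamma n) c.
  move=> /porbitP[i ->]; apply/porbitP; exists i.+1.
  by rewrite expgSr permM [in RHS]permE.
by move=> /orP[/orP[]|] /eqP->; rewrite ?step // porbit_id.
Qed.

Lemma card_porbit_gamma c : c != e_word n -> #|porbit (gamma n) c| = 3.
Proof.
move=> /cycw_uniq c_uniq; rewrite porbit_gamma.
rewrite -[RHS]/(size [:: c; cycw c; cycw (cycw c)]) -(card_uniqP c_uniq).
by apply: eq_card => w; rewrite !inE orbA.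
Qed.

End Orbits.

(** Orbits that share a point coincide, and no orbit is empty. *)
Lemma partition_porbits_cover (T : finType) (s : {perm T})
    (O : {set {set T}}) : O \subset porbits s -> partition O (cover O).
Proof.
move=> /subsetP sO; rewrite /partition eqxx /=; apply/andP; split.
  apply/trivIsetP => A B /sO/imsetP[x _ ->] /sO/imsetP[y _ ->].
  apply: contraR => /pred0Pn[z /= /andP[]].
  by rewrite -!eq_porbit_mem => /eqP<- /eqP<-.
by apply/negP => /sO/imsetP[x _ /setP/(_ x)]; rewrite inE porbit_id.
Qed.

(** * The families of orbits through C_+ and C_- *)

Section Classes.
Variables (n : nat) (b : word n).
Implicit Types c : word n.

Lemma cycw_e : cycw (e_word n) = e_word n.
Proof. by apply/eqP; rewrite cycw_fixed. Qed.

Lemma cycw_eq_e c : (cycw c == e_word n) = (c == e_word n).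
Proof. by rewrite -{1}cycw_e (inj_eq (@cycw_inj n)). Qed.

Lemma e_word_Cplus : e_word n \in Cplus b.
Proof. by rewrite CplusE inE cycw_e wmul_sign_e. Qed.

Lemma Cminus_neq_e c : c \in Cminus b -> c != e_word n.
Proof. by rewrite CminusE inE; apply: contraTneq => ->; rewrite wmul_sign_e. Qed.

Lemma porbit_Cplus c c' : c' \in porbit (gamma n) c ->
  (c' \in Cplus b :\ e_word n) = (c \in Cplus b :\ e_word n).
Proof.
rewrite porbit_gamma !in_setU !in_set1 => /orP[/orP[]|] /eqP-> //;
  by rewrite !in_setD1 !cycw_eq_e !Cplus_cyc.
Qed.

Definition plus_orbits : {set {set word n}} :=
  [set porbit (gamma n) c | c in Cplus b :\ e_word n].

Definition minus_orbits : {set {set word n}} :=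
  [set porbit (gamma n) c | c in Cminus b].

Lemma plus_orbits_sub : plus_orbits \subset porbits (gamma n).
Proof. by apply/subsetP => o /imsetP[c _ ->]; apply: imset_f. Qed.

Lemma minus_orbits_sub : minus_orbits \subset porbits (gamma n).
Proof. by apply/subsetP => o /imsetP[c _ ->]; apply: imset_f. Qed.

Lemma cover_plus_orbits : cover plus_orbits = Cplus b :\ e_word n.
Proof.
apply/setP => c; apply/bigcupP/idP => [[o /imsetP[c' c'_in ->]]|c_in].
  by move=> /porbit_Cplus->.
by exists (porbit (gamma n) c); [apply: imset_f | apply: porbit_id].
Qed.

(** The predecessor accounts for [e_word n], which lies in C_+; every remaining orbit has three
    elements. The factor 3 stays on the left to avoid division of natural numbers. *)
Lemma card_plus_orbits : b != e_word n -> (#|plus_orbits| * 3)%N = (4 ^ n.-1).-1.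
Proof.
move=> b_neq_e; have part := partition_porbits_cover plus_orbits_sub.
rewrite -(card_uniform_partition _ part) => [|o /imsetP[c]]; last first.
  by rewrite !inE => /andP[c_neq_e _] ->; apply: card_porbit_gamma.
rewrite cover_plus_orbits -(card_sign_class false b_neq_e) -CplusE.
by rewrite [in RHS](cardsD1 (e_word n)) e_word_Cplus.
Qed.

Lemma porbit_Cminus c : c \in Cminus b ->
  porbit (gamma n) c :&: Cminus b = [set c].
Proof.
move=> c_in; have [c1 c2 _ _] := Cminus_cyc c_in.
apply/setP => w; rewrite porbit_gamma in_setI !in_setU !in_set1.
apply/andP/eqP => [[/orP[/orP[]|] /eqP-> // w_in]|->]; last by rewrite eqxx.
  by rewrite w_in in c1.
by rewrite w_in in c2.
Qed.

(** An element of C_- is recovered from its orbit as the only point of C_- there, so taking orbits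
    is injective on C_-. *)
Lemma card_minus_orbits : b != e_word n -> #|minus_orbits| = (4 ^ n.-1)%N.
Proof.
move=> b_neq_e; rewrite card_in_imset ?CminusE ?card_sign_class //.
rewrite -CminusE => c c' c_in c'_in cc'; apply/set1P.
by rewrite -(porbit_Cminus c'_in) -cc' porbit_Cminus ?set11.
Qed.

Lemma disjoint_orbits : [disjoint minus_orbits & plus_orbits].
Proof.
apply/pred0Pn => -[o /andP[/= /imsetP[c c_in ->] /imsetP[c' c'_in cc']]].
have : c \in Cplus b :\ e_word n by rewrite (@porbit_Cplus c' c) -?cc' ?porbit_id.
rewrite in_setD1 => /andP[_]; move: c_in; rewrite CplusE CminusE !inE.
by move=> /andP[/eqP->].
Qed.

Lemma Cminus_transversal :
  is_transversal (Cminus b) minus_orbits (cover minus_orbits).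
Proof.
rewrite /is_transversal (partition_porbits_cover minus_orbits_sub) /=.
apply/andP; split.
  apply/subsetP => c c_in; apply/bigcupP.
  by exists (porbit (gamma n) c); [apply: imset_f | apply: porbit_id].
apply/forall_inP => o /imsetP[c c_in ->].
by rewrite setIC porbit_Cminus // cards1.
Qed.

End Classes.

(** * Rotation by 120 degrees and its action on centroids *)

Section Centroids.
Variable R : realType.
Implicit Types (p : 'rV[R]_2) (a : R).

(** As 240 = -120 modulo 360, the duplication formula gives c = 2 c^2 - 1, with roots 1 and -1/2;
    the cosine is negative because 120 = 30 + 90. *)
Lemma cos120 : cos (degree 120) = - 2^-1 :> R.
Proof.
have half (c : R) : c = c ^+ 2 *+ 2 - 1 -> c < 0 -> c = - 2^-1.
  move=> c2 c_lt0; have : (c - 1) * (2 * c + 1) = 0.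
    by rewrite [RHS](_ : 0 = c ^+ 2 *+ 2 - 1 - c); [ring | rewrite -c2 subrr].
  by move=> /eqP; rewrite mulf_eq0 => /orP[] /eqP ?; lra.
have t2 : degree 120 *+ 2 = - degree 120 + pi *+ 2 :> R.
  by rewrite /degree; field.
apply: half; first by rewrite -cos_mulr2n t2 cosD2pi cosN.
rewrite (_ : degree 120 = pi / 6 + pi / 2); last by rewrite /degree; field.
rewrite cosDpihalf oppr_lt0 sin_gt0_pi //.
by have := pi_gt0 R; move=> ?; apply/andP; split; lra.
Qed.

Lemma sin120_sqr : sin (degree 120) ^+ 2 = 3 / 4 :> R.
Proof. by rewrite sin2cos2 cos120; field. Qed.

(** The rotation by -120 degrees about the origin. *)
Definition turn p : 'rV[R]_2 :=
  point (cos (degree 120) * p 0 0 + sin (degree 120) * p 0 1)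
        (cos (degree 120) * p 0 1 - sin (degree 120) * p 0 0).

Lemma point0 (x y : R) : point x y 0 0 = x.
Proof. by rewrite mxE. Qed.

Lemma point1 (x y : R) : point x y 0 1 = y.
Proof. by rewrite mxE. Qed.

Lemma row2P p (q : 'rV[R]_2) : p 0 0 = q 0 0 -> p 0 1 = q 0 1 -> p = q.
Proof.
move=> e0 e1; apply/rowP => j; case: (unliftP 0 j) => [k|] -> //.
by rewrite (ord1 k) (_ : lift _ _ = 1) //; apply: val_inj.
Qed.

Lemma turn_polar a : turn (polar a) = polar (a - 120).
Proof.
have -> : polar (a - 120) =
    point (cos (degree a - degree 120)) (sin (degree a - degree 120)).
  by rewrite /polar (_ : degree (a - 120) = degree a - degree 120) // /degree; ring.
by rewrite /turn !point0 !point1 cosB sinB; congr point; ring.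
Qed.

Lemma polarDturn a : polar (a + 360) = polar a.
Proof.
rewrite /polar (_ : degree (a + 360) = degree a + pi *+ 2); last first.
  by rewrite /degree; field.
by rewrite cosD2pi sinD2pi.
Qed.

Lemma vdigit_cyc (x : digit) : vdigit R (cyc x) = turn (vdigit R x).
Proof.
case: x; rewrite /= ?turn_polar.
- by congr polar; ring.
(* Here 90 - 120 = -30, and a full turn is added to reach 330. *)
- by rewrite -[RHS]polarDturn; congr polar; ring.
- by congr polar; ring.
by apply: row2P; rewrite ?point0 ?point1 !mxE; ring.
Qed.

Lemma centroid_cyc n (d1 : R) (c : word n) :
  centroid d1 (cycw c) = turn (centroid d1 c).
Proof.
(* The signs sigma_r depend only on the positions of 7, which gamma preserves. *)
have coef r : #|[set s : 'I_n | (s < r)%N & cycw c s == D7]|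
            = #|[set s : 'I_n | (s < r)%N & c s == D7]|.
  apply: eq_card => s; rewrite !inE ffunE; congr andb.
  by apply/eqP/eqP; case: (c s).
rewrite /centroid; apply: row2P; rewrite ?point0 ?point1 !summxE !mulr_sumr;
  rewrite -?big_split -?sumrB; apply: eq_bigr => r _ /=.
all: by rewrite coef ffunE vdigit_cyc !mxE /=; ring.
Qed.

(** * Nonvanishing of centroids *)

Definition dot p (q : 'rV[R]_2) : R := p 0 0 * q 0 0 + p 0 1 * q 0 1.

Lemma dot_polar a a' : dot (polar a) (polar a') = cos (degree a - degree a').
Proof. by rewrite /dot !point0 !point1 cosB. Qed.

Lemma dot_vdigit_le1 (x y : digit) : `|dot (vdigit R x) (vdigit R y)| <= 1.
Proof.
by case: x; case: y; rewrite /= ?dot_polar ?cos_max // /dot !mxE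
  ?mul0r ?mulr0 addr0 normr0.
Qed.

Lemma dot_vdigit_self (x : digit) : x != D7 -> dot (vdigit R x) (vdigit R x) = 1.
Proof. by case: x => [|||/eqP//] _; rewrite /= dot_polar subrr cos0. Qed.

(* The leading term outweighs the sum of all the later ones, as the dyadic
   tail is finite. *)
Lemma dyadic_sum_neq0 n (d1 : R) (F : 'I_n -> R) (r0 : 'I_n) : 0 < d1 ->
  (forall r : 'I_n, (r < r0)%N -> F r = 0) -> `|F r0| = d1 / 2 ^+ r0 ->
  (forall r, `|F r| <= d1 / 2 ^+ r) -> \sum_(r < n) F r != 0.
Proof.
move=> d1_gt0 F_lt F_r0 F_le; apply/eqP; rewrite (bigD1 r0) //=.
move=> /eqP; rewrite addr_eq0 => /eqP/(congr1 Num.norm); rewrite normrN F_r0.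
apply/eqP; rewrite gt_eqF //; apply: le_lt_trans (ler_norm_sum _ _ _) _.
have -> : \sum_(r < n | r != r0) `|F r| = \sum_(r < n | (r0 < r)%N) `|F r|.
  rewrite big_mkcond [RHS]big_mkcond; apply: eq_bigr => r _.
  by case: (ltngtP r0 r) => [|/F_lt->|/val_inj->];
    rewrite ?eqxx ?normr0 ?if_same // => /gtn_eqF; rewrite -val_eqE /= => ->.
apply: (@le_lt_trans _ _ (\sum_(r0.+1 <= r < n) d1 / 2 ^+ r)).
  rewrite big_geq_mkord; apply: ler_sum => r _; exact: F_le.
(* The tail telescopes to d_1/2^r0 - 2 d_1/2^n, strictly below the leading term. *)
rewrite (telescope_sumr_eq (fun r => - (2 * d1 / 2 ^+ r))) ?ltn_ord //.
  have p_gt0 k : 0 < d1 / 2 ^+ k by rewrite divr_gt0 // exprn_gt0.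
  have := p_gt0 n; rewrite exprS.
  have -> : 2 * d1 / (2 * 2 ^+ r0) = d1 / 2 ^+ r0.
    by field; rewrite expf_neq0 ?pnatr_eq0.
  by rewrite -mulrA => ?; lra.
by move=> k _; rewrite exprS; field; rewrite expf_neq0 ?pnatr_eq0.
Qed.

Lemma centroid_neq0 n (d1 : R) (c : word n) : 0 < d1 -> c != e_word n ->
  centroid d1 c != 0.
Proof.
move=> d1_gt0 c_neq_e; have [r1 cr1] : exists r1, c r1 != D7.
  apply/existsP; rewrite -negb_forall; apply: contra c_neq_e => /forallP ce.
  by apply/eqP/ffunP => r; rewrite ffunE; apply/eqP.
have [r0 cr0 r0_min] :=
  @arg_minnP _ r1 (fun r => c r != D7) (fun r : 'I_n => r : nat) cr1.
(* Projecting onto the unit vector of the first symbol other than 7 turns the claim into one about a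
   sum of real numbers. *)
suff : dot (centroid d1 c) (vdigit R (c r0)) != 0.
  by apply: contraNneq => ->; rewrite /dot !mxE !mul0r addr0.
rewrite /dot !summxE !mulr_suml -big_split /=.
have coefN (k r : nat) : `|(-1) ^+ k * d1 / 2 ^+ r| = d1 / 2 ^+ r.
  by rewrite -mulrA normrM normrX normrN1 expr1n mul1r gtr0_norm //
     divr_gt0 // exprn_gt0.
under eq_bigr => r _ do rewrite !mxE -!mulrA -!mulrDr !mulrA -/(dot _ _).
apply: (dyadic_sum_neq0 (r0 := r0) d1_gt0).
- move=> r r_lt; have -> : c r = D7.
    by apply: contraTeq r_lt => /r0_min; rewrite -leqNgt.
  by rewrite /dot !mxE !mul0r addr0 mulr0.
- by rewrite normrM coefN dot_vdigit_self // normr1 mulr1.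
- move=> r; rewrite normrM coefN ler_piMr ?dot_vdigit_le1 //.
  by rewrite ltW // divr_gt0 // exprn_gt0.
Qed.

(** * The triangle formed by a point and its two rotations *)

Lemma turn_equilateral p :
  equilateral_triangle p (turn p) (turn (turn p)).
Proof.
have edistE q q' : edist q q' =
    Num.sqrt ((q 0 0 - q' 0 0) ^+ 2 + (q 0 1 - q' 0 1) ^+ 2) :> R.
  by rewrite /edist !big_ord_recl big_ord0 addr0
    (_ : lift ord0 ord0 = 1) //; apply: val_inj.
pose S : R := sin (degree 120); pose N : R := p 0 0 ^+ 2 + p 0 1 ^+ 2.
rewrite /equilateral_triangle.
(* Only the cosine is evaluated here, which makes these polynomial identities in [S]; at
   [S ^+ 2 = 3 / 4] all three radicands equal [3 * N]. *)
suff [-> -> ->] : [/\ edist p (turn p) = Num.sqrt ((9 / 4 + S ^+ 2) * N),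
    edist (turn p) (turn (turn p)) =
      Num.sqrt ((9 / 4 + S ^+ 2) * (1 / 4 + S ^+ 2) * N) &
    edist (turn (turn p)) p = Num.sqrt (((3 / 4 + S ^+ 2) ^+ 2 + S ^+ 2) * N)].
  by rewrite /S sin120_sqr; split; congr Num.sqrt; field.
rewrite !edistE !(point0, point1) cos120 -/S /N.
by split; congr Num.sqrt; field.
Qed.

Lemma turn_centered p : centered_at_origin p (turn p) (turn (turn p)).
Proof.
rewrite /centered_at_origin (_ : p + _ + _ = 0) ?scaler0 //.
apply: row2P; rewrite !mxE /= cos120; set S := sin _.
  (* The coefficient is 1 - 1/2 + (1/4 - S^2); the terms in the other coordinate cancel. *)
  have -> : 0 = (3 / 4 - S ^+ 2) * p 0 0 by rewrite sin120_sqr subrr mul0r.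
  by field.
have -> : 0 = (3 / 4 - S ^+ 2) * p 0 1 by rewrite sin120_sqr subrr mul0r.
by field.
Qed.

Lemma det_mx2 (A : 'M[R]_2) : \det A = A 0 0 * A 1 1 - A 0 1 * A 1 0.
Proof.
have lift01 (k : 'I_1) : lift 0 k = 1 :> 'I_2 by rewrite ord1; apply: val_inj.
have lift10 (k : 'I_1) : lift 1 k = 0 :> 'I_2 by rewrite ord1; apply: val_inj.
rewrite (expand_det_row _ 0) !big_ord_recl big_ord0 /cofactor !det_mx11 !mxE.
by rewrite !lift01 lift10 expr0 expr1; ring.
Qed.

Lemma det_col_mx2 p (q : 'rV[R]_2) :
  \det (col_mx p q : 'M_2) = p 0 0 * q 0 1 - p 0 1 * q 0 0.
Proof.
have E0 j : (col_mx p q : 'M_2) 0 j = p 0 j.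
  by rewrite -(col_mxEu p q); congr (col_mx p q _ j); apply: val_inj.
have E1 j : (col_mx p q : 'M_2) 1 j = q 0 j.
  by rewrite -(col_mxEd p q); congr (col_mx p q _ j); apply: val_inj.
by rewrite det_mx2 !E0 !E1.
Qed.

Lemma turn_nondegenerate p : p != 0 ->
  nondegenerate_triangle p (turn p) (turn (turn p)).
Proof.
move=> p_neq0; have S_neq0 : sin (degree 120) != 0 :> R.
  by rewrite -sqrf_eq0 sin120_sqr mulf_neq0 ?invr_eq0 ?pnatr_eq0.
have p2_neq0 : p 0 0 ^+ 2 + p 0 1 ^+ 2 != 0.
  rewrite paddr_eq0 ?sqr_ge0 // !sqrf_eq0; apply: contra p_neq0.
  by move=> /andP[/eqP p0 /eqP p1]; apply/eqP/row2P; rewrite mxE.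
rewrite /nondegenerate_triangle row_free_unit unitmxE unitfE.
rewrite det_col_mx2 !mxE /= cos120; set S := sin _.
(* The determinant of the two edge vectors is a nonzero multiple of the squared length of [p]. *)
rewrite (_ : _ - _ = - (9 / 4 + S ^+ 2) * S * (p 0 0 ^+ 2 + p 0 1 ^+ 2));
  last by field.
rewrite !mulf_neq0 // oppr_eq0 sin120_sqr.
by rewrite (_ : 9 / 4 + 3 / 4 = 3) ?pnatr_eq0 //; field.
Qed.

End Centroids.

Theorem corollary6p11 (R : realType) (n : nat) (d1 : R) (b : word n)
  (n_ge1 : (1 <= n)%N) (d1_gt0 : 0 < d1) (b_neq_e : b != e_word n) :
  exists O T : {set {set word n}},
    [/\ O \subset porbits (gamma n),
        partition O (Cplus b :\ e_word n),
        #|O|%:R = (4 ^+ n.-1 - 1) / 3 :> rat &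
        forall o : {set word n}, o \in O ->
          exists c1 c2 c3 : word n,
            [/\ uniq [:: c1; c2; c3],
                o = [set c1; c2; c3],
                nondegenerate_triangle
                  (centroid d1 c1) (centroid d1 c2) (centroid d1 c3),
                equilateral_triangle
                  (centroid d1 c1) (centroid d1 c2) (centroid d1 c3) &
                centered_at_origin
                  (centroid d1 c1) (centroid d1 c2) (centroid d1 c3)]]
    /\
    [/\ T \subset porbits (gamma n),
        [disjoint T & O],
        #|T| = (4 ^ n.-1)%N,
        is_transversal (Cminus b) T (cover T) &
        forall o : {set word n}, o \in T ->
          exists c1 c2 c3 : word n,
            [/\ uniq [:: c1; c2; c3],
                o = [set c1; c2; c3],
                o :&: Cminus b = [set c1],
                wanticommute c2 b &
                wanticommute c3 b]].
Proof.
exists (plus_orbits b), (minus_orbits b); split; split.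
- exact: plus_orbits_sub.
- by rewrite -cover_plus_orbits (partition_porbits_cover (plus_orbits_sub b)).
- have /(congr1 (fun k => k%:R : rat)) := card_plus_orbits b_neq_e.
  rewrite natrM -subn1 natrB ?expn_gt0 // natrX => <-.
  by rewrite mulfK.
- move=> o /imsetP[c]; rewrite in_setD1 => /andP[c_neq_e _] ->.
  exists c, (cycw c), (cycw (cycw c)).
  rewrite cycw_uniq // porbit_gamma !centroid_cyc; split=> //.
  + exact/turn_nondegenerate/centroid_neq0.
  + exact: turn_equilateral.
  + exact: turn_centered.
- exact: minus_orbits_sub.
- exact: disjoint_orbits.
- exact: card_minus_orbits.
- exact: Cminus_transversal.
move=> o /imsetP[c c_in ->]; exists c, (cycw c), (cycw (cycw c)).
have [_ _ anti1 anti2] := Cminus_cyc c_in.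
by rewrite cycw_uniq ?(Cminus_neq_e c_in) // porbit_Cminus // -porbit_gamma.
Qed.
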